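(* Let $T,\bar\sigma\in(0,\infty)$, let $(\Omega,\mathcal F,\mathbb P)$ be a probability space and let $\xi^{l,k}\colon\Omega\to\mathbb R$, $l\in\mathbb N_0$, $k\in\mathbb N$, be a family of independent normally distributed random variables with mean zero and standard deviation $\bar\sigma$. Let $Y^{N,l,k}_n\colon\Omega\to\mathbb R$, $n\in\{0,1,\dots,N\}$, $N\in\mathbb N$, $l\in\mathbb N_0$, $k\in\mathbb N$, be the Euler approximations defined by $Y^{N,l,k}_0:=\xi^{l,k}$ and $$Y^{N,l,k}_{n+1}:=Y^{N,l,k}_n-\bigl(Y^{N,l,k}_n\bigr)^5\cdot\frac TN$$ for all $n\in\{0,1,\dots,N-1\}$, $N\in\mathbb N$, $l\in\mathbb N_0$, $k\in\mathbb N$. Then $$\lim_{\substack{N\to\infty\\ \log_2(N)\in\mathbb N}}\left|\frac1N\sum_{k=1}^{N}\bigl|Y^{1,0,k}_1\bigr|^p+\sum_{l=1}^{\log_2(N)}\frac{2^l}{N}\sum_{k=1}^{N/2^l}\Bigl(\bigl|Y^{2^l,l,k}_{2^l}\bigr|^p-\bigl|Y^{2^{(l-1)},l,k}_{2^{(l-1)}}\bigr|^p\Bigr)\right|=\infty$$ $\mathbb P$-almost surely for all $p\in(0,\infty)$.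
   Context: $\mathbb N=\{1,2,3,\dots\}$, $\mathbb N_0=\{0,1,2,\dots\}$. The limit is taken along $N\in\{2^1,2^2,2^3,\dots\}$. The $Y^{N,l,k}$ are Euler approximations with step size $T/N$ of the random ordinary differential equation $dX_t=-X_t^5\,dt$, $t\in[0,T]$, with normally distributed initial value. *)

(* Defs.v *)
From HB Require Import structures.
From mathcomp Require Import all_boot all_order all_algebra.
From mathcomp Require Import all_classical all_reals all_analysis.

Set Implicit Arguments.
Unset Strict Implicit.
Unset Printing Implicit Defensive.

Import Order.TTheory GRing.Theory Num.Theory.
Import numFieldNormedType.Exports.

Local Open Scope classical_set_scope.
Local Open Scope ring_scope.

(** Mutual independence of the subfamily of [X] indexed by [D]; finite index
    subsets of [D] are given as duplicate-free sequences. *)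
Definition mutually_independent (R : realType) (d : measure_display)
    (Omega : measurableType d) (P : probability Omega R)
    (I : choiceType) (D : set I) (X : I -> {RV P >-> R}) : Prop :=
  forall (J : seq I) (A : I -> set R),
    uniq J -> (forall i, i \in J -> D i) ->
    (forall i, i \in J -> measurable (A i)) ->
    P (\bigcap_(i in [set` J]) (X i @^-1` A i)) =
      (\prod_(i <- J) P (X i @^-1` A i))%E.

(** [s] is the standard deviation; equality of laws is only required on Borel
    sets. *)
Definition normally_distributed (R : realType) (d : measure_display)
    (Omega : measurableType d) (P : probability Omega R)
    (m s : R) (X : {RV P >-> R}) : Prop :=
  forall A : set R, measurable A -> distribution P X A = normal_prob m s A.

(** [euler T N x n] is the [n]-th Euler iterate with step size [T / N], started
    in [x], for dX_t = - X_t ^ 5 dt; only [n <= N] and [0 < N] are meaningful. *)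
Fixpoint euler (R : realType) (T : R) (N : nat) (x : R) (n : nat) : R :=
  if n is n'.+1 then
    let y := euler T N x n' in y - y ^+ 5 * (T / N%:R)
  else x.

(** Multilevel Monte Carlo Euler estimator of the [p]-th absolute moment for one
    realization [x] of the initial values.  It is only meaningful when [N] is a
    power of two, in which case [trunc_log 2 N] is the exact logarithm and the
    divisions [N %/ 2 ^ l] are exact. *)
Definition mlmc_euler (R : realType) (T p : R) (x : nat -> nat -> R)
    (N : nat) : R :=
  let Y M l k n := euler T M (x l k) n in
  N%:R^-1 * (\sum_(1 <= k < N.+1) `|Y 1%N 0%N k 1%N| `^ p) +
  \sum_(1 <= l < (trunc_log 2 N).+1)
    (2 ^ l)%:R / N%:R *
    \sum_(1 <= k < (N %/ 2 ^ l).+1)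
      (`|Y (2 ^ l)%N l k (2 ^ l)%N| `^ p -
       `|Y (2 ^ l.-1)%N l k (2 ^ l.-1)%N| `^ p).

Definition positive_powers_of_two : set nat :=
  [set N | exists2 m : nat, (0 < m)%N & N = (2 ^ m)%N].

(* Main.v *)
Require Import Defs.
From mathcomp Require Import all_boot all_order all_algebra.
From mathcomp Require Import all_classical all_reals all_analysis.
From mathcomp Require Import measurable_realfun ring lra zify.
Import Order.TTheory GRing.Theory Num.Theory.
Import numFieldNormedType.Exports.
Local Open Scope classical_set_scope.
Local Open Scope ring_scope.

(* Write N = 2 ^ L and r_l = (2 * 2 ^ l / T) ^ (1 / 4). With 2 ^ l steps the
   Euler iterates started in x do not grow if |x| <= r_l, whereas a relative
   excess 1 + e over r_l, or over another such starting value, is amplified to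
   at least (1 + e) ^ (5 ^ (2 ^ l)). Group the estimator by the number 2 ^ l of
   steps: the group of l is the fine mean of level l minus the coarse mean of
   level l + 1, and let l be the last group with a sample above r_l. Almost
   surely, for all large L,
   - all samples are at most 2 ^ (3 L);
   - samples stay 2 ^ (- 10 L) away from the thresholds and from the samples of
     the next level, by boundedness of the normal density and independence;
   - 2 ^ l >= 16 L, because the level with about 16 L steps still has about
     2 ^ L / L samples and each exceeds r_l with probability at least
     exp (- O (sqrt L)).
   The group of l then dominates: the largest of its starting values, fine or
   coarse, beats the competing mean by a doubly exponential factor, so the two
   means cannot cancel; groups with fewer steps are at most
   2 ^ (4 L p * 5 ^ (2 ^ (l - 1))), and those with more steps do not explode. *)

(** * Growth of the Euler iterates *)

Section euler_iterates.
Context {R : realType}.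
Implicit Types (T h r q x y : R) (N n : nat).

Lemma euler_normS T N x n :
  `|euler T N x n.+1| =
  `|euler T N x n| * `|1 - `|euler T N x n| ^+ 4 * (T / N%:R)|.
Proof.
rewrite /=; set y := euler T N x n; rewrite -normrX (@ger0_norm _ (y ^+ 4)).
  by rewrite -normrM; congr `|_|; ring.
by rewrite exprn_even_ge0.
Qed.

Variables (T r : R) (N : nat).
Hypotheses (T_gt0 : 0 < T) (r_gt0 : 0 < r) (rE : r ^+ 4 * (T / N%:R) = 2).

Let h_gt0 : 0 < T / N%:R.
Proof.
have := ltr0n R 2; rewrite -rE pmulr_rgt0 //; exact: exprn_gt0.
Qed.

Lemma euler_le_start x n : `|x| <= r -> `|euler T N x n| <= `|x|.
Proof.
move=> xr; elim: n => [//|n IHn]; rewrite euler_normS.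
apply: (le_trans _ IHn); rewrite ler_piMr // ler_norml.
have hr : `|euler T N x n| ^+ 4 <= r ^+ 4.
  by rewrite lerXn2r ?nnegrE ?normr_ge0 ?(ltW r_gt0)// (le_trans IHn).
have h0 : 0 <= `|euler T N x n| ^+ 4 by rewrite exprn_ge0.
have := ler_wpM2r (ltW h_gt0) hr; rewrite rE => h2.
have := mulr_ge0 h0 (ltW h_gt0); lra.
Qed.

(* Above [r] the modulus is mapped by [a |-> a (a^4 T/N - 1)], and enlarging
   [a] by a factor [q] enlarges the image by at least [q^5]. *)
Lemma euler_ratio_growth q x y n : 1 <= q -> r <= `|x| -> q * `|x| <= `|y| ->
  r <= `|euler T N x n| /\
  q ^+ (5 ^ n) * `|euler T N x n| <= `|euler T N y n|.
Proof.
move=> q1 rx qxy; elim: n => [|n [IHr IHq]]; first by rewrite expn0 expr1.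
rewrite !euler_normS expnS mulnC exprM.
have := exprn_ege1 (5 ^ n) q1.
move: (_ ^+ (5 ^ n)) IHq => c; move: `|euler T N x n| `|euler T N y n| IHr.
move=> a b ra cab c1; set h := T / N%:R.
have a0 : 0 < a by exact: lt_le_trans ra.
have ca0 : 0 < c * a by rewrite mulr_gt0 ?(lt_le_trans _ c1).
have rah : 1 <= a ^+ 4 * h - 1.
  have : r ^+ 4 <= a ^+ 4.
    by rewrite lerXn2r ?nnegrE // ltW.
  by move=> /(ler_wpM2r (ltW h_gt0)); rewrite rE -/h; lra.
have cabh : c ^+ 4 * (a ^+ 4 * h - 1) <= b ^+ 4 * h - 1.
  have : (c * a) ^+ 4 <= b ^+ 4.
    by rewrite lerXn2r ?nnegrE ?(ltW ca0) // (le_trans (ltW ca0)).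
  move=> /(ler_wpM2r (ltW h_gt0)); rewrite -/h exprMn.
  by have := exprn_ege1 4 c1; lra.
have c4 := exprn_ege1 4 c1.
have bh : 1 <= b ^+ 4 * h - 1.
  by apply: le_trans cabh; apply: mulr_ege1.
rewrite ![`|1 - _|]distrC !ger0_norm; [|lra|lra]; split.
  by rewrite (le_trans ra) // ler_peMr // ltW.
rewrite (_ : _ * _ = c * a * (c ^+ 4 * (a ^+ 4 * h - 1))); last by ring.
apply: ler_pM => //; first exact: ltW.
by rewrite mulr_ge0 //; lra.
Qed.

Lemma euler_threshold n : `|euler T N r n| = r.
Proof.
elim: n => [|n IHn]; first by rewrite /= gtr0_norm.
by rewrite euler_normS IHn rE opprD addrA subrr sub0r normrN normr1 mulr1.
Qed.

Lemma euler_dominates q x y n : 1 <= q ->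
  q * Num.max r `|x| <= `|y| ->
  q ^+ (5 ^ n) * Num.max r `|euler T N x n| <= `|euler T N y n|.
Proof.
move=> q1 qy.
have q0 : 0 <= q by lra.
have [rx|rx] := leP r `|x|.
  rewrite (max_r rx) in qy.
  by have [rxn qyn] := euler_ratio_growth q x y n q1 rx qy; rewrite max_r.
rewrite (max_l (ltW rx)) in qy.
have xn := euler_le_start x n (ltW rx).
rewrite (@max_l _ _ r) ?(le_trans xn (ltW rx)) //.
have rr : r <= `|r| by rewrite gtr0_norm.
have qy' : q * `|r| <= `|y| by rewrite gtr0_norm.
have [_] := euler_ratio_growth q r y n q1 rr qy'.
by rewrite euler_threshold.
Qed.

End euler_iterates.

Lemma euler_ub {R : realType} (T x : R) (N n : nat) : 0 < T -> (0 < N)%N ->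
  (1 + T) * Num.max 1 `|euler T N x n| <=
  ((1 + T) * Num.max 1 `|x|) ^+ (5 ^ n).
Proof.
move=> T0 N0; elim: n => [|n IHn]; first by rewrite expn0 expr1.
rewrite expnS mulnC exprM euler_normS; apply: (@le_trans _ _
  (((1 + T) * Num.max 1 `|euler T N x n|) ^+ 5)); last first.
  by rewrite lerXn2r ?nnegrE ?(le_trans _ IHn) // mulr_ge0 ?le_max ?ler01//;
     lra.
set a := `|euler T N x n|; set b := Num.max 1 a.
have a0 : 0 <= a by exact: normr_ge0.
have b1 : 1 <= b by rewrite le_max lexx.
have ab : a <= b by rewrite le_max lexx orbT.
have hT : T / N%:R <= T.
  by rewrite ler_pdivrMr ?ltr0n// ler_peMr ?(ltW T0)// ler1n.
have h0 : 0 <= T / N%:R by rewrite divr_ge0 // ltW.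
have b4 : 1 <= b ^+ 4 by rewrite exprn_ege1.
have a4b4 : a ^+ 4 <= b ^+ 4 by rewrite lerXn2r ?nnegrE // (le_trans ler01).
have a40 : 0 <= a ^+ 4 by rewrite exprn_ge0.
have bnd : `|1 - a ^+ 4 * (T / N%:R)| <= (1 + T) * b ^+ 4.
  rewrite ler_norml; have : a ^+ 4 * (T / N%:R) <= b ^+ 4 * T by exact: ler_pM.
  have := mulr_ge0 a40 h0.
  have : 0 <= b ^+ 4 * T by rewrite mulr_ge0 // ?ltW //; lra.
  lra.
have T1 : 1 <= (1 + T) ^+ 4 by rewrite exprn_ege1 //; lra.
have b5 : 1 <= b ^+ 5 by rewrite exprn_ege1.
have step : Num.max 1 (a * `|1 - a ^+ 4 * (T / N%:R)|) <= (1 + T) * b ^+ 5.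
  rewrite ge_max; apply/andP; split; first by rewrite mulr_ege1//; lra.
  rewrite (_ : (1 + T) * b ^+ 5 = b * ((1 + T) * b ^+ 4)); last by ring.
  exact: ler_pM.
apply: (@le_trans _ _ ((1 + T) * ((1 + T) * b ^+ 5))).
  by rewrite ler_wpM2l //; lra.
rewrite exprMn mulrA -expr2 ler_wpM2r ?(le_trans ler01) //.
by rewrite ler_weXn2l //; lra.
Qed.

Definition threshold {R : realType} (T : R) (l : nat) : R :=
  Num.sqrt (Num.sqrt (2 * (2 ^ l)%:R / T)).

Section threshold.
Context {R : realType}.
Variable T : R.
Hypothesis T_gt0 : 0 < T.

Lemma threshold_sqr l :
  threshold T l ^+ 2 = Num.sqrt (2 * (2 ^ l)%:R / T).
Proof. by rewrite sqr_sqrtr // sqrtr_ge0. Qed.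

Lemma threshold_gt0 l : 0 < threshold T l.
Proof. by rewrite !sqrtr_gt0 divr_gt0 // mulr_gt0 // ltr0n expn_gt0. Qed.

Lemma thresholdX4 l : threshold T l ^+ 4 * (T / (2 ^ l)%:R) = 2.
Proof.
rewrite (exprM _ 2 2) threshold_sqr sqr_sqrtr.
  have h : (2 ^ l)%:R != 0 :> R by rewrite pnatr_eq0 expn_eq0.
  by have := lt0r_neq0 T_gt0 => T0; field; rewrite h T0.
by rewrite divr_ge0 ?(ltW T_gt0) // mulr_ge0.
Qed.

Lemma threshold0_le l : threshold T 0 <= threshold T l.
Proof.
rewrite /threshold !ler_wsqrtr // ler_pM2r ?invr_gt0 // ler_pM2l //.
by rewrite ler_nat leq_exp2l.
Qed.

End threshold.

Section mean.
Context {R : realType}.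
Implicit Types (n k : nat) (f : nat -> R).

Definition mean n f : R := n%:R^-1 * \sum_(1 <= k < n.+1) f k.

Lemma mean_ge0 n f : (forall k, 0 <= f k) -> 0 <= mean n f.
Proof. by move=> f0; rewrite mulr_ge0 ?invr_ge0 ?sumr_ge0. Qed.

Lemma mean_le n f b : (0 < n)%N ->
  (forall k, (0 < k <= n)%N -> f k <= b) -> mean n f <= b.
Proof.
move=> n0 fb; rewrite /mean ler_pdivrMl ?ltr0n //.
apply: (@le_trans _ _ (\sum_(1 <= k < n.+1) b)).
  by apply: ler_sum_nat => k; rewrite ltnS; apply: fb.
by rewrite sumr_const_nat subn1 mulr_natl.
Qed.

Lemma mean_ge n f k : (forall j, 0 <= f j) -> (0 < k <= n)%N ->
  f k / n%:R <= mean n f.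
Proof.
move=> f0 /andP[k0 kn]; rewrite mulrC ler_wpM2l ?invr_ge0 //.
rewrite (big_cat_nat (n := k)) //=; last by rewrite ltnW.
rewrite big_nat_recl // addrA addrAC lerDr addr_ge0 // sumr_ge0 //.
Qed.

End mean.

Lemma ge2_exp_addVn {R : realType} (e : nat) : (0 < e)%N ->
  2 <= (1 + e%:R^-1) ^+ e :> R.
Proof.
move=> e0; have he : 0 <= e%:R^-1 :> R by rewrite invr_ge0.
have H n : 1 + n%:R * e%:R^-1 <= (1 + e%:R^-1) ^+ n :> R.
  elim: n => [|n IHn]; first by rewrite mul0r addr0 expr0.
  rewrite exprS -natr1; move: IHn; move: e%:R^-1 he => c c0.
  move=> /(ler_wpM2l (_ : 0 <= 1 + c)); rewrite addr_ge0// => /(_ isT).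
  have : 0 <= n%:R * c * c by rewrite !mulr_ge0.
  lra.
by apply: le_trans (H e); rewrite divff // pnatr_eq0 -lt0n.
Qed.

(** * Lower bound for the estimator *)

Section deterministic_divergence.
Context {R : realType}.
Variables (T p : R).
Hypotheses (T_gt0 : 0 < T) (p_gt0 : 0 < p).
Implicit Types (x : nat -> nat -> R) (u v : nat -> R) (L l k n : nat).

Definition euler_mean n l u : R :=
  mean n (fun k => `|euler T (2 ^ l) (u k) (2 ^ l)| `^ p).

Lemma euler_mean_ge0 n l u : 0 <= euler_mean n l u.
Proof. by apply: mean_ge0 => k; apply: powR_ge0. Qed.

Definition coarse_mean x L l : R :=
  if (l < L)%N then euler_mean (2 ^ (L - l.+1)) l (x l.+1) else 0.

(* Summation by parts: terms are grouped by their number [2 ^ l] of Euler steps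
   rather than by level. *)
Lemma mlmc_euler_by_steps x L :
  mlmc_euler T p x (2 ^ L) =
  \sum_(l < L.+1) (euler_mean (2 ^ (L - l)) l (x l) - coarse_mean x L l).
Proof.
have w l : (l <= L)%N ->
    (2 ^ l)%:R / (2 ^ L)%:R = (2 ^ (L - l))%:R^-1 :> R.
  move=> lL; rewrite -[in (2 ^ L)%N](subnKC lL) expnD natrM invfM mulrA divff.
    by rewrite mul1r.
  by rewrite pnatr_eq0 expn_eq0.
rewrite sumrB big_ord_recl subn0 [X in _ - X]big_ord_recr /= {2}/coarse_mean.
rewrite ltnn addr0 -addrA -sumrB; congr +%R.
rewrite /mlmc_euler trunc_expnK // big_add1 /= big_mkord; apply: eq_bigr => l _.
rewrite /coarse_mean ltn_ord w // -expnB // /euler_mean /mean /bump add1n.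
by rewrite -mulrBr -sumrB.
Qed.

Lemma euler_mean_le n l u b : (0 < n)%N -> 0 <= b ->
  (forall k, (0 < k <= n)%N -> `|euler T (2 ^ l) (u k) (2 ^ l)| <= b) ->
  euler_mean n l u <= b `^ p.
Proof.
move=> n0 b0 ub; apply: mean_le => // k /ub.
by apply: ge0_ler_powR; rewrite ?nnegrE ?(ltW p_gt0).
Qed.

Lemma euler_mean_gap L l n n' u v q k0 : 1 <= q -> (0 < n <= 2 ^ L)%N ->
  (0 < n')%N -> (0 < k0 <= n)%N ->
  (forall k, (0 < k <= n')%N ->
     q * Num.max (threshold T l) `|v k| <= `|u k0|) ->
  2 * (2 ^ L)%:R <= (q ^+ (5 ^ 2 ^ l)) `^ p ->
  (threshold T l * q ^+ (5 ^ 2 ^ l)) `^ p / (2 * (2 ^ L)%:R) <=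
  euler_mean n l u - euler_mean n' l v.
Proof.
move=> q1 /andP[n0 nL] n'0 k0n quv Q2.
have dom k : (0 < k <= n')%N -> q ^+ (5 ^ 2 ^ l) *
    Num.max (threshold T l) `|euler T (2 ^ l) (v k) (2 ^ l)| <=
    `|euler T (2 ^ l) (u k0) (2 ^ l)|.
  move=> kn; apply: euler_dominates => //; [exact: threshold_gt0| |exact: quv].
  exact: thresholdX4.
have Q0 : 1 <= q ^+ (5 ^ 2 ^ l) by rewrite exprn_ege1.
move: (q ^+ _) Q0 dom Q2 => Q Q1 dom Q2.
set X := `|euler T (2 ^ l) (u k0) (2 ^ l)| in dom.
have L0 : 0 < (2 ^ L)%:R :> R by rewrite ltr0n expn_gt0.
have Q0 : 0 <= Q by rewrite (le_trans ler01).
have r0 := ltW (threshold_gt0 _ T_gt0 l).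
have QX : (threshold T l * Q) `^ p <= X `^ p.
  apply: ge0_ler_powR; rewrite ?nnegrE ?(ltW p_gt0) ?mulr_ge0 ?normr_ge0 //.
  rewrite mulrC; apply: le_trans (dom 1%N _) => //.
  by rewrite ler_wpM2l // le_max lexx.
have Qp0 : 0 < Q `^ p by apply: lt_le_trans Q2; rewrite mulr_gt0.
have fine_ge : X `^ p / (2 ^ L)%:R <= euler_mean n l u.
  apply: le_trans (mean_ge n _ k0 _ k0n); last by move=> j; apply: powR_ge0.
  by rewrite ler_wpM2l ?powR_ge0 // lef_pV2 ?posrE ?ler_nat ?ltr0n ?expn_gt0 //.
have coarse_le : euler_mean n' l v <= X `^ p / (2 * (2 ^ L)%:R).
  apply: (@le_trans _ _ (X `^ p / Q `^ p)); last first.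
    by rewrite ler_wpM2l ?powR_ge0 // lef_pV2 // posrE mulr_gt0.
  apply: mean_le => // k kn; rewrite ler_pdivlMr // -powRM //.
  apply: ge0_ler_powR; rewrite ?nnegrE ?(ltW p_gt0) ?mulr_ge0 ?normr_ge0 //.
  rewrite mulrC; apply: le_trans (dom k kn).
  by rewrite ler_wpM2l // le_max lexx orbT.
apply: (@le_trans _ _ (X `^ p / (2 * (2 ^ L)%:R))).
  by rewrite ler_wpM2r // invr_ge0 mulr_ge0.
have -> : X `^ p / (2 * (2 ^ L)%:R) =
    X `^ p / (2 ^ L)%:R - X `^ p / (2 * (2 ^ L)%:R).
  have := lt0r_neq0 L0; move: (_ `^ p) => c; move: (2 ^ L)%:R => d d0.
  by field.
exact: lerB.
Qed.

End deterministic_divergence.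

Lemma nat_range_argmax {R : realDomainType} (n : nat) (f : nat -> R) :
  (0 < n)%N -> exists2 k, (0 < k <= n)%N &
    forall j, (0 < j <= n)%N -> f j <= f k.
Proof.
elim: n => [//|[_ _|n /(_ isT)[k kn fk] _]].
  by exists 1%N => // j j1; rewrite (_ : j = 1%N) //; lia.
have [fkn|fnk] := leP (f k) (f n.+2).
  exists n.+2; rewrite ?leqnn // => j /andP[j0]; rewrite leq_eqVlt ltnS.
  by move=> /orP[/eqP->//|jn]; rewrite (le_trans (fk j _)) // j0.
exists k; first by lia.
move=> j /andP[j0]; rewrite leq_eqVlt ltnS.
by move=> /orP[/eqP->|jn]; rewrite ?(ltW fnk) // fk // j0.
Qed.

Lemma leq5n_exp (L : nat) : (0 < L)%N -> (5 * L <= 2 ^ (3 * L))%N.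
Proof.
elim: L => // -[//|L] /(_ isT) IHL _.
by rewrite (_ : 3 * L.+2 = 3 + 3 * L.+1)%N ?expnD; lia.
Qed.

Lemma growth_factor_ge {R : realType} (L l : nat) : (0 < L)%N -> (0 < l)%N ->
  (16 * L <= 2 ^ l)%N ->
  2 ^+ (5 * L * 5 ^ 2 ^ l.-1) <=
    (1 + (2 ^ (13 * L))%:R^-1) ^+ (5 ^ 2 ^ l) :> R.
Proof.
move=> L0 l0 Ll; set e := (2 ^ (13 * L))%N; set m := (5 ^ 2 ^ l.-1)%N.
have e0 : (0 < e)%N by rewrite expn_gt0.
have m_ge : (e * (5 * L) <= m)%N.
  apply: (@leq_trans (2 ^ (16 * L))).
    have -> : (16 * L = 13 * L + 3 * L)%N by lia.
    by rewrite expnD leq_mul // leq5n_exp.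
  apply: (@leq_trans (2 ^ 2 ^ l)); first by rewrite leq_exp2l.
  by rewrite -(prednK l0) expnS expnM /m leq_exp2r // expn_gt0.
have mm : (5 ^ 2 ^ l = m * m)%N.
  by rewrite /m -expnD addnn -mul2n -expnS prednK.
apply: (@le_trans _ _ (((1 + e%:R^-1) ^+ e) ^+ (5 * L * m))).
  by rewrite lerXn2r ?nnegrE ?exprn_ge0 ?ge2_exp_addVn //.
rewrite -exprM; apply: ler_weXn2l; first by rewrite lerDl invr_ge0.
by rewrite mm mulnA leq_mul.
Qed.

Section mlmc_lower_bound.
Context {R : realType}.
Variables (T p : R) (x : nat -> nat -> R) (L : nat).
Hypotheses (T_gt0 : 0 < T) (p_gt0 : 0 < p).
Hypotheses (L_gt0 : (0 < L)%N) (L_T : 1 + T <= 2 ^+ L) (L_p : 3 <= p * 2 ^+ L)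
  (L_thr : 4 <= threshold T 0 `^ p * 2 ^+ L).
Hypothesis x_ub : forall l k, (l <= L)%N -> (0 < k <= 2 ^ L)%N ->
  `|x l k| <= 2 ^+ (3 * L).
Hypothesis x_thr : forall l j k, (l <= L)%N -> (j <= L)%N ->
  (0 < k <= 2 ^ L)%N ->
  2^-1 ^+ (10 * L) < `| `|x l k| - threshold T j|.
Hypothesis x_sep : forall l j k, (l < L)%N -> (0 < k <= 2 ^ L)%N ->
  (0 < j <= 2 ^ L)%N ->
  2^-1 ^+ (10 * L) < `| `|x l k| - `|x l.+1 j| |.

Let q : R := 1 + (2 ^ (13 * L))%:R^-1.
Let q_ge1 : 1 <= q. Proof. by rewrite lerDl invr_ge0. Qed.

Lemma separated_ratio (a b r : R) : a <= 2 ^+ (3 * L) ->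
  2^-1 ^+ (10 * L) < `|a - b| -> b < a ->
  2^-1 ^+ (10 * L) < `|a - r| -> r < a ->
  q * Num.max r b <= a.
Proof.
move=> aB ab ba ar ra.
rewrite ger0_norm in ab; last by lra.
rewrite ger0_norm in ar; last by lra.
have eE : (2 ^ (13 * L))%:R^-1 * 2 ^+ (3 * L) = 2^-1 ^+ (10 * L) :> R.
  have -> : (13 * L = 10 * L + 3 * L)%N by lia.
  rewrite natrX exprD.
  have B0 : 2 ^+ (3 * L) != 0 :> R by rewrite expf_neq0.
  by rewrite invfM divfK // exprVn.
have i0 : 0 <= (2 ^ (13 * L))%:R^-1 :> R by rewrite invr_ge0.
set c := Num.max r b.
have ca : c + 2^-1 ^+ (10 * L) < a by rewrite /c maxEle; case: ifP => _; lra.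
have e0 : 0 <= 2^-1 ^+ (10 * L) :> R by rewrite exprn_ge0 // invr_ge0.
have cB : c <= 2 ^+ (3 * L) by lra.
by rewrite /q mulrDl mul1r; have := ler_wpM2l i0 cB; rewrite eE; lra.
Qed.

Let in_range l k : (0 < k <= 2 ^ (L - l))%N -> (0 < k <= 2 ^ L)%N.
Proof.
move=> /andP[-> kl] /=; apply: leq_trans kl _.
by rewrite leq_exp2l // leq_subr.
Qed.

Definition has_explosion (l : nat) : Prop := (l <= L)%N /\
  ((exists2 k, (0 < k <= 2 ^ (L - l))%N & threshold T l < `|x l k|) \/
   ((l < L)%N /\ exists2 k, (0 < k <= 2 ^ (L - l.+1))%N &
      threshold T l < `|x l.+1 k|)).

Let step_difference (l : nat) : R :=
  euler_mean T p (2 ^ (L - l)) l (x l) - coarse_mean T p x L l.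

Lemma explosion_lower_bound l : has_explosion l ->
  2 * (2 ^ L)%:R <= (q ^+ (5 ^ 2 ^ l)) `^ p ->
  (threshold T l * q ^+ (5 ^ 2 ^ l)) `^ p / (2 * (2 ^ L)%:R) <=
  `|step_difference l|.
Proof.
move=> [lL xl] qL; rewrite /step_difference.
have n0 i : (0 < 2 ^ i)%N by rewrite expn_gt0.
have nL i : (0 < 2 ^ (L - i) <= 2 ^ L)%N by rewrite n0 leq_exp2l ?leq_subr.
have [k kn xk] := nat_range_argmax (2 ^ (L - l)) (fun k => `|x l k|) (n0 _).
have kL := in_range _ _ kn.
rewrite /coarse_mean; case: ltnP => [lL'|Ll].
  have [j jn xj] :=
    nat_range_argmax (2 ^ (L - l.+1)) (fun k => `|x l.+1 k|) (n0 _).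
  have jL := in_range _ _ jn.
  have {}xl : threshold T l < Num.max `|x l k| `|x l.+1 j|.
    rewrite lt_max; case: xl => [[i ik xi]|[_ [i ik xi]]].
      by rewrite (lt_le_trans xi) // xk.
    by rewrite (lt_le_trans xi (xj _ _)) ?orbT.
  have [kj|jk|kj] := ltgtP `|x l k| `|x l.+1 j|.
  - rewrite distrC; apply: le_trans (ler_norm _).
    rewrite (max_r (ltW kj)) in xl.
    apply: (euler_mean_gap _ _ _ _ _ _ _ _ _ _ _ j) => // i il.
    have iL := in_range _ _ il.
    apply: separated_ratio => //; first exact: x_ub.
    - by rewrite distrC x_sep.
    - by apply: le_lt_trans kj; apply: xk.
    - exact: x_thr.
  - apply: le_trans (ler_norm _).
    rewrite (max_l (ltW jk)) in xl.
    apply: (euler_mean_gap _ _ _ _ _ _ _ _ _ _ _ k) => // i il.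
    have iL := in_range _ _ il.
    apply: separated_ratio => //; first exact: x_ub.
    - by rewrite x_sep.
    - by apply: le_lt_trans jk; apply: xj.
    - exact: x_thr.
  - have := x_sep _ _ _ lL' kL jL; rewrite kj subrr normr0 ltNge.
    by rewrite exprn_ge0 // invr_ge0.
have {}xl : threshold T l < `|x l k|.
  case: xl => [[i ik xi]|[]]; last by rewrite ltnNge Ll.
  by rewrite (lt_le_trans xi) // xk.
rewrite subr0; apply: le_trans (ler_norm _).
pose z := fun _ : nat => 0 : R.
apply: (@le_trans _ _ (euler_mean T p (2 ^ (L - l)) l (x l)
  - euler_mean T p 1 l z)); last first.
  by rewrite gerBl euler_mean_ge0.
apply: (euler_mean_gap _ _ _ _ _ _ _ _ _ _ _ k) => // i il.
have thr := x_thr _ _ _ lL lL kL.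
apply: separated_ratio => //; first exact: x_ub.
  rewrite normr0 subr0 normr_id; apply: (lt_le_trans thr).
  have := threshold_gt0 _ T_gt0 l.
  by rewrite ger0_norm; lra.
by rewrite normr0 (lt_trans _ xl) // threshold_gt0.
Qed.

Hypothesis x_explodes : exists l k, [/\ (l <= L)%N, (16 * L <= 2 ^ l)%N,
  (0 < k <= 2 ^ (L - l))%N & threshold T l < `|x l k|].

Lemma last_explosion : exists l, [/\ (16 * L <= 2 ^ l)%N, has_explosion l &
  forall j, has_explosion j -> (j <= l)%N].
Proof.
have [l [k [lL Ll kl xlk]]] := x_explodes.
have exl : exists j, `[< has_explosion j >].
  by exists l; apply/asboolP; split => //; left; exists k.
have ubl j : `[< has_explosion j >] -> (j <= L)%N by move=> /asboolP[].
exists (ex_maxn exl ubl); case: ex_maxnP => i /asboolP xi imax; split => //.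
  have /imax li : `[< has_explosion l >].
    by apply/asboolP; split => //; left; exists k.
  by apply: leq_trans Ll _; rewrite leq_exp2l.
by move=> j xj; apply: imax; apply/asboolP.
Qed.

Lemma exp2_ge_self (n : nat) : n%:R <= 2 ^+ n :> R.
Proof. by rewrite -natrX ler_nat ltnW // ltn_expl. Qed.

Lemma exp2_ge1 (n : nat) : 1 <= 2 ^+ n :> R.
Proof. by rewrite exprn_ege1 // ler1n. Qed.

Lemma other_steps_bound l j : has_explosion l ->
  (forall i, has_explosion i -> (i <= l)%N) ->
  (j <= L)%N -> j != l ->
  `|step_difference j| <= (2 ^+ (4 * L * 5 ^ 2 ^ l.-1)) `^ p.
Proof.
move=> xl lmax jL jl; set m := (5 ^ 2 ^ l.-1)%N.
have m0 : (0 < m)%N by rewrite expn_gt0.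
have B0 : 0 <= 2 ^+ (4 * L * m) :> R by rewrite (le_trans ler01) ?exp2_ge1.
have n0 i : (0 < 2 ^ i)%N by rewrite expn_gt0.
suff ub i k : (i <= L)%N -> (0 < k <= 2 ^ L)%N ->
    ((l < j)%N -> `|x i k| <= threshold T j) ->
    `|euler T (2 ^ j) (x i k) (2 ^ j)| <= 2 ^+ (4 * L * m).
  rewrite /step_difference.
  have fine : euler_mean T p (2 ^ (L - j)) j (x j) <= (2 ^+ (4 * L * m)) `^ p.
    apply: euler_mean_le => // k kj; have kL := in_range _ _ kj.
    apply: ub => // lj; rewrite leNgt; apply/negP => xj.
    have /lmax : has_explosion j by split => //; left; exists k.
    by rewrite leqNgt lj.
  have coarse : coarse_mean T p x L j <= (2 ^+ (4 * L * m)) `^ p.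
    rewrite /coarse_mean; case: ltnP => [jL'|_]; last exact: powR_ge0.
    apply: euler_mean_le => // k kj; have kL := in_range _ _ kj.
    apply: ub => // lj; rewrite leNgt; apply/negP => xj.
    have /lmax : has_explosion j by split => //; right; split => //; exists k.
    by rewrite leqNgt lj.
  have fine0 := euler_mean_ge0 T p (2 ^ (L - j)) j (x j).
  have coarse0 : 0 <= coarse_mean T p x L j.
    by rewrite /coarse_mean; case: ifP => _ //; apply: euler_mean_ge0.
  by rewrite ler_norml; lra.
move=> iL kL; move: jl; rewrite neq_ltn => /orP[jl _|lj /(_ lj) xr].
  have xB : Num.max 1 `|x i k| <= 2 ^+ (3 * L).
    by rewrite ge_max x_ub // exp2_ge1.
  have T1 : 0 <= 1 + T by rewrite addr_ge0 ?(ltW T_gt0).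
  have mx0 (y : R) : 1 <= Num.max 1 y by rewrite le_max lexx.
  apply: (@le_trans _ _
      ((1 + T) * Num.max 1 `|euler T (2 ^ j) (x i k) (2 ^ j)|)).
    apply: (@le_trans _ _ (Num.max 1 `|euler T (2 ^ j) (x i k) (2 ^ j)|)).
      by rewrite le_max lexx orbT.
    by rewrite ler_peMl ?(le_trans ler01 (mx0 _)) // lerDl ltW.
  apply: (le_trans (euler_ub _ _ _ _ T_gt0 (n0 j))).
  apply: (@le_trans _ _ ((2 ^+ (4 * L)) ^+ (5 ^ 2 ^ j))).
    rewrite lerXn2r ?nnegrE ?exprn_ge0 //.
      by rewrite mulr_ge0 // (le_trans ler01).
    have -> : (4 * L = L + 3 * L)%N by lia.
    by rewrite exprD ler_pM // (le_trans ler01).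
  rewrite -exprM ler_weXn2l ?ler1n // leq_mul // leq_exp2l // leq_exp2l //.
  by rewrite -ltnS (ltn_predK jl).
have Ej := thresholdX4 T T_gt0 j.
apply: (@le_trans _ _ `|x i k|).
  by apply: euler_le_start xr => //; exact: threshold_gt0.
apply: (le_trans (x_ub _ _ iL kL)); rewrite ler_weXn2l ?ler1n //.
by rewrite -(muln1 (3 * L)%N) leq_mul // leq_mul.
Qed.

Lemma mlmc_euler_ge : L%:R <= `|mlmc_euler T p x (2 ^ L)|.
Proof.
have [l [Ll xl lmax]] := last_explosion.
have lL : (l < L.+1)%N by case: xl.
have l0 : (0 < l)%N by case: (l) Ll => [|//]; rewrite expn0; lia.
set m := (5 ^ 2 ^ l.-1)%N.
set K : R := (2 ^+ (4 * L * m)) `^ p.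
set V : R := (2 ^+ (L * m)) `^ p.
have mL : (2 ^ L <= m)%N.
  apply: (@leq_trans (2 ^ 2 ^ l.-1)).
    rewrite leq_exp2l //.
    have : (2 ^ l = 2 * 2 ^ l.-1)%N by rewrite -expnS prednK.
    lia.
  by rewrite leq_exp2r // expn_gt0.
have KV : K * V <= (q ^+ (5 ^ 2 ^ l)) `^ p.
  rewrite -powRM ?exprn_ge0 // -exprD.
  apply: ge0_ler_powR; rewrite ?nnegrE ?exprn_ge0 ?(ltW p_gt0) //.
    by rewrite (le_trans ler01).
  have -> : (4 * L * m + L * m = 5 * L * m)%N by lia.
  exact: growth_factor_ge.
have K1 : 1 <= K.
  have : 1 `^ p <= K; last by rewrite powR1.
  apply: ge0_ler_powR; rewrite ?nnegrE ?(ltW p_gt0) //.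
  exact: exp2_ge1.
have V8 : 2 ^+ (3 * L) <= V.
  rewrite /V -!powR_mulrn // -powRrM; apply: ler_powR; first by rewrite ler1n.
  have mp : 3 <= p * m%:R.
    by apply: (le_trans L_p); rewrite ler_pM2l // -natrX ler_nat.
  rewrite !natrM -mulrA (mulrC m%:R) [leLHS]mulrC.
  exact: ler_wpM2l.
set N : R := 2 ^+ L.
have N1 : 1 <= N by exact: exp2_ge1.
have NL : L%:R <= N by exact: exp2_ge_self.
have N2 : 2 <= N by rewrite /N -{1}(expr1 2) ler_weXn2l // ler1n.
have V3 : N * (N * N) <= V.
  apply: le_trans V8; rewrite -!exprD.
  by have -> : (L + (L + L) = 3 * L)%N by lia.
have NN : 1 <= N * N by rewrite mulr_ege1.
have V0 : 0 <= V by apply: powR_ge0.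
have K0 : 0 <= K by apply: powR_ge0.
have gap : 2 * K * L%:R <= `|step_difference l|.
  apply: le_trans (explosion_lower_bound _ xl _); last first.
    apply: (le_trans _ KV); rewrite natrX -/N.
    apply: (@le_trans _ _ V); last by rewrite ler_peMl.
    apply: le_trans V3; rewrite mulrC; apply: ler_wpM2l; first by lra.
    by apply: (le_trans N2); rewrite ler_peMl //; lra.
  rewrite powRM ?(ltW (threshold_gt0 _ T_gt0 l)) //; last first.
    by rewrite exprn_ge0 // (le_trans ler01).
  rewrite natrX -/N ler_pdivlMr; last by lra.
  have th : threshold T 0 `^ p <= threshold T l `^ p.
    apply: ge0_ler_powR; rewrite ?nnegrE ?(ltW p_gt0) ?sqrtr_ge0 //.
    exact: threshold0_le.
  apply: (@le_trans _ _ (threshold T 0 `^ p * (K * V))); last first.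
    by apply: ler_pM => //; rewrite ?powR_ge0 ?mulr_ge0.
  apply: (@le_trans _ _ (threshold T 0 `^ p * (K * (N * (N * N))))); last first.
    by rewrite ler_wpM2l ?powR_ge0 // ler_wpM2l.
  have -> : threshold T 0 `^ p * (K * (N * (N * N))) =
    (threshold T 0 `^ p * N) * (K * N * N) by ring.
  apply: (@le_trans _ _ (4 * (K * N * N))).
    have -> : 2 * K * L%:R * (2 * N) = 4 * (K * L%:R * N) by ring.
    by rewrite ler_wpM2l // ler_wpM2r ?(le_trans ler01) // ler_wpM2l.
  by rewrite ler_wpM2r // !mulr_ge0 ?(le_trans ler01 N1).
rewrite mlmc_euler_by_steps -/(step_difference _) (bigD1 (Ordinal lL)) //=.
rewrite -/(step_difference l).
set rest := \sum_(i < L.+1 | _) _.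
have rest_le : `|rest| <= K * L%:R.
  apply: (le_trans (ler_norm_sum _ _ _)).
  apply: (@le_trans _ _ (\sum_(i < L.+1 | i != Ordinal lL) K)).
    apply: ler_sum => i il; apply: other_steps_bound => //.
    by rewrite -ltnS ltn_ord.
  rewrite sumr_const cardC1 card_ord mulr_natr lexx //.
have LK : L%:R <= K * L%:R by rewrite ler_peMl.
apply: le_trans (lerB_normD _ _).
lra.
Qed.

End mlmc_lower_bound.

(** * Probability estimates *)

Section probability_bounds.
Context {R : realType} {d : measure_display} {Omega : measurableType d}
  (P : probability Omega R).
Local Open Scope ereal_scope.

Lemma borel_cantelli_geometric (F : nat -> set Omega) (C : R) (n0 : nat) :
  (0 <= C)%R -> (forall n, measurable (F n)) ->
  (forall n, (n0 <= n)%N -> P (F n) <= (C * 2^-1 ^+ n)%:E) ->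
  {ae P, forall w, exists n1, forall n, (n1 <= n)%N -> ~ F n w}.
Proof.
move=> C0 mF PF; pose G n := F (n + n0)%N.
have mG n : measurable (G n) by exact: mF.
have G0 : P (lim_sup_set G) = 0.
  apply: lim_sup_set_cvg0 => //.
  apply: (@le_lt_trans _ _ (2 * C)%R%:E); last exact: ltry.
  have C20 : (0 <= 2 * C)%R by rewrite mulr_ge0.
  have := @epsilon_trick R (fun=> 0) _ xpredT (fun=> lexx _) C20.
  rewrite [X in _ <= X + _ -> _]eseries0 // add0e.
  apply: le_trans; apply: lee_nneseries => // n _.
  rewrite add0e; apply: le_trans (PF _ (leq_addl _ _)) _; rewrite lee_fin.
  rewrite expnS natrM invfM mulrACA divff // mul1r natrX -exprVn.
  rewrite ler_wpM2l // exprD ler_piMr ?exprn_ge0 ?invr_ge0 //.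
  by rewrite exprn_ile1 ?invr_ge0 // invf_le1 // ler1n.
exists (lim_sup_set G); split => //.
  by apply: bigcap_measurable => // k _; exact: bigcup_measurable.
move=> w /= /asboolPn/asboolP Fw n _; apply: contrapT => Gw; apply: Fw.
exists (n + n0)%N => k nk Fk; apply: Gw; exists (k - n0)%N => /=.
  by rewrite leq_subRL; lia.
by rewrite /G subnK //; lia.
Qed.

Lemma iota_union_bound (a n : nat) (A : nat -> set Omega) (b : R) :
  (forall k, (a <= k < a + n)%N -> measurable (A k)) ->
  (forall k, (a <= k < a + n)%N -> P (A k) <= b%:E) ->
  P (\bigcup_(k in [set` iota a n]) A k) <= (n%:R * b)%:E.
Proof.
move=> mA PA; rewrite bigcup_seq.
elim: n a mA PA => [|n IHn] a mA PA; first by rewrite big_nil measure0 mul0r.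
have an : (a <= a < a + n.+1)%N by lia.
have step k : (a.+1 <= k < a.+1 + n)%N -> (a <= k < a + n.+1)%N by lia.
rewrite big_cons; apply: le_trans (measureU2 _ _ _) _.
- exact: mA.
- rewrite -bigcup_seq; apply: fin_bigcup_measurable => // k /=.
  by rewrite mem_iota => /step; apply: mA.
rewrite -natr1 mulrDl mul1r EFinD [X in _ <= X]addeC.
apply: leeD; first exact: PA.
by apply: IHn => k /step; [apply: mA|apply: PA].
Qed.

End probability_bounds.

Lemma measurable_norm_gt {R : realType} (t : R) :
  measurable [set y : R | t < `|y|].
Proof.
have m : measurable_fun setT (fun y : R => `|y|) by exact: normr_measurable.
rewrite (_ : [set y | _] = (fun y : R => `|y|) @^-1` [set` `]t, +oo[]).
  by rewrite -[X in measurable X]setTI; apply: m.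
by apply/seteqP; split => y /=; rewrite in_itv /= andbT.
Qed.

Lemma measurable_norm_near {R : realType} (c e : R) :
  measurable [set y : R | `| `|y| - c| <= e].
Proof.
have m : measurable_fun setT (fun y : R => `| `|y| - c|).
  apply: measurableT_comp; first exact: normr_measurable.
  by apply: measurable_funB => //; exact: normr_measurable.
rewrite (_ : [set y | _] =
    (fun y : R => `| `|y| - c|) @^-1` [set` `]-oo, e]]).
  by rewrite -[X in measurable X]setTI; apply: m.
by apply/seteqP; split => y /=; rewrite in_itv.
Qed.

Section normal_bounds.
Context {R : realType}.
Variable s : R.
Hypothesis s_gt0 : 0 < s.

Let s_neq0 : s != 0. Proof. by rewrite gt_eqF. Qed.

Lemma normal_prob_itv_le (a b : R) : a <= b ->
  (normal_prob 0 s `[a, b] <= (normal_peak s * (b - a))%:E)%E.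
Proof.
move=> ab; apply: (@le_trans _ _
    (\int[lebesgue_measure]_(x in `[a, b]) (cst (normal_peak s)%:E x))%E).
  apply: ge0_le_integral => //=.
  - by move=> x _; rewrite lee_fin normal_pdf_ge0.
  - apply/measurable_EFinP; apply: measurable_funTS.
    exact: measurable_normal_pdf.
  - by move=> x _; rewrite lee_fin normal_pdf_ub.
rewrite integral_cst //= lebesgue_measure_itv /= EFinM lee_wpmul2l //.
  by rewrite lee_fin normal_peak_ge0.
case: ifP => _; first by rewrite EFinB.
by rewrite lee_fin subr_ge0.
Qed.

Lemma normal_prob_near_le (c e : R) : 0 <= e ->
  (normal_prob 0 s [set y | (`| `|y| - c| <= e)%R] <=
   (4 * normal_peak s * e)%:E)%E.
Proof.
move=> e0.
apply: (@le_trans _ _ (normal_prob 0 s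
  (`[c - e, (c + e)%R] `|` `[- c - e, (- c + e)%R]))).
  apply: le_measure; rewrite ?inE.
  - exact: measurable_norm_near.
  - exact: measurableU.
  - move=> y /=; rewrite !in_itv /= ler_norml => /andP[h1 h2].
    by case: (ger0P y) h1 h2 => y0 h1 h2; [left|right]; lra.
apply: le_trans (measureU2 _ _ _) _ => //.
have h1 := normal_prob_itv_le (c - e) (c + e).
have h2 := normal_prob_itv_le (- c - e) (- c + e).
apply: le_trans (leeD (h1 _) (h2 _)) _; [lra|lra|].
by rewrite -EFinD lee_fin; lra.
Qed.

Lemma normal_prob_tail_ge (r : R) : 0 <= r ->
  ((normal_pdf 0 s (r + 1))%:E <= normal_prob 0 s [set y | (r < `|y|)%R])%E.
Proof.
move=> r0; apply: (@le_trans _ _ (normal_prob 0 s `]r, (r + 1)%R])); last first.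
  apply: le_measure; rewrite ?inE //.
    exact: measurable_norm_gt.
  move=> y /=; rewrite in_itv /= => /andP[ry _].
  by rewrite (lt_le_trans ry) ?ler_norm.
apply: (@le_trans _ _ (\int[lebesgue_measure]_(x in `]r, (r + 1)%R])
    (cst (normal_pdf 0 s (r + 1))%:E x))%E).
  rewrite integral_cst //= lebesgue_measure_itv /= lte_fin ltrDl ltr01.
  by rewrite -EFinB addrAC subrr add0r mule1.
apply: ge0_le_integral => //=.
- by move=> x _; rewrite lee_fin normal_pdf_ge0.
- apply/measurable_EFinP; apply: measurable_funTS.
  exact: measurable_normal_pdf.
move=> x; rewrite in_itv /= => /andP[rx xr].
rewrite lee_fin !normal_pdfE // ler_wpM2l ?normal_peak_ge0 //.
rewrite /normal_fun ler_expR !subr0 !mulNr lerN2 ler_wpM2r //.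
  by rewrite invr_ge0 mulrn_wge0 // sqr_ge0.
by rewrite lerXn2r ?nnegrE //; lra.
Qed.

(* For [|y| > t] the density is at most [2 exp (- 3 t^2 / (8 s^2))] times the
   centred normal density of standard deviation [2 s], whose total mass is 1. *)
Lemma normal_prob_tail_le (t : R) : 0 < t ->
  (normal_prob 0 s [set y | (t < `|y|)%R] <= (16 / 3 * s ^+ 2 / t ^+ 2)%:E)%E.
Proof.
move=> t0; pose c := 2 * expR (- (3 / 8 * t ^+ 2 / s ^+ 2)).
have c0 : 0 <= c by rewrite mulr_ge0 // expR_ge0.
have mt := measurable_norm_gt t.
have s2 : 2 * s != 0 by rewrite mulf_neq0.
have mpdf s' (D : set R) :
    measurable_fun D (fun x => (normal_pdf 0 s' x)%:E).
  apply/measurable_EFinP; apply: measurable_funTS.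
  exact: measurable_normal_pdf.
apply: (@le_trans _ _ (\int[lebesgue_measure]_(x in [set y | (t < `|y|)%R])
    (c%:E * (normal_pdf 0 (2 * s) x)%:E))%E).
  apply: ge0_le_integral => //=.
  - by move=> x _; rewrite lee_fin normal_pdf_ge0.
  - exact: mpdf.
  - by apply: measurable_funeM; exact: mpdf.
  move=> x tx; rewrite -EFinM lee_fin !normal_pdfE //.
  have peakE : normal_peak (2 * s) = 2^-1 * normal_peak s.
    rewrite /normal_peak -invfM; congr _^-1.
    rewrite exprMn -mulrA -mulrnAr sqrtrM ?exprn_ge0 //.
    by rewrite sqrtr_sqr ger0_norm.
  rewrite peakE /normal_fun !subr0.
  have -> : c * (2^-1 * normal_peak s * expR (- x ^+ 2 / ((2 * s) ^+ 2 *+ 2))) =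
    normal_peak s * (expR (- (3 / 8 * t ^+ 2 / s ^+ 2)) *
       expR (- x ^+ 2 / ((2 * s) ^+ 2 *+ 2))).
    by rewrite /c; field.
  rewrite ler_wpM2l ?normal_peak_ge0 // -expRD ler_expR.
  have -> : - x ^+ 2 / (s ^+ 2 *+ 2) =
    - (3 / 8 * x ^+ 2 / s ^+ 2) + - x ^+ 2 / ((2 * s) ^+ 2 *+ 2).
    by field.
  rewrite lerD2r lerN2 ler_wpM2r ?invr_ge0 ?sqr_ge0 // ler_wpM2l //.
  rewrite -(real_normK (num_real x)) lerXn2r ?nnegrE ?normr_ge0 ?(ltW t0) //.
  exact: ltW.
rewrite (ge0_integralZl lebesgue_measure mt (mpdf _ _)) //; last first.
  by move=> x _; rewrite lee_fin normal_pdf_ge0.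
apply: (@le_trans _ _ (c%:E * 1)%E).
  apply: lee_wpmul2l; first by rewrite lee_fin.
  exact: (probability_le1 (normal_prob 0 (2 * s)) mt).
rewrite mule1 lee_fin /c.
set y := 3 / 8 * t ^+ 2 / s ^+ 2.
have y0 : 0 < y by rewrite !mulr_gt0 ?invr_gt0 ?exprn_gt0.
have -> : 16 / 3 * s ^+ 2 / t ^+ 2 = 2 * y^-1.
  by rewrite /y; field; rewrite s_neq0 gt_eqF.
rewrite ler_wpM2l // expRN lef_pV2 ?posrE ?expR_gt0 //.
by have := expR_ge1Dx y; lra.
Qed.

End normal_bounds.

Lemma exists_natr_ge {R : realType} (x : R) : exists n : nat, x <= n%:R.
Proof. by exists (Num.truncn x).+1; rewrite ltW // truncnS_gt. Qed.

Lemma exp2_unbounded {R : realType} (c x : R) : 0 < c ->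
  exists n0 : nat, forall n, (n0 <= n)%N -> x <= c * 2 ^+ n.
Proof.
move=> c0; have [n0 xn0] := exists_natr_ge (x / c); exists n0 => n nn.
rewrite mulrC -ler_pdivrMr //; apply: (le_trans xn0).
by rewrite -natrX ler_nat (leq_trans nn) // ltnW // ltn_expl.
Qed.

Lemma leq32_exp (n : nat) : (8 <= n)%N -> (32 * n <= 2 ^ n)%N.
Proof.
elim: n => // n IHn; rewrite leq_eqVlt => /orP[/eqP <-//|].
by rewrite ltnS => n8; have := IHn n8; rewrite expnS; lia.
Qed.

Lemma prode_le_exp {R : realType} {I : eqType} (s : seq I) (f : I -> \bar R)
    (a : R) : (forall i, 0 <= f i)%E -> {in s, forall i, (f i <= a%:E)%E} ->
  (\prod_(i <- s) f i <= (a ^+ size s)%:E)%E.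
Proof.
move=> f0; elim: s => [|i s IHs] fa; first by rewrite big_nil.
rewrite big_cons /= exprS EFinM; apply: lee_pmul => //.
- exact: prode_ge0.
- by apply: fa; rewrite mem_head.
- by apply: IHs => j js; apply: fa; rewrite inE js orbT.
Qed.

(* The level whose number of time steps is of order [L]: its explosion threshold
   is of order [L ^ (1 / 4)] while it still has [2 ^ L / O(L)] samples. *)
Definition explosive_level (L : nat) : nat := trunc_log 2 L + 5.

Lemma explosive_level_bounds L : (0 < L)%N ->
  (16 * L <= 2 ^ explosive_level L <= 32 * L)%N.
Proof.
move=> L0; have /andP[h1 h2] := trunc_log_bounds (isT : (1 < 2)%N) L0.
by rewrite /explosive_level expnD; move: h2; rewrite expnS; lia.
Qed.

Lemma explosive_level_le L : (8 <= L)%N -> (explosive_level L <= L)%N.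
Proof.
move=> L8; have /andP[_ h] : (16 * L <= 2 ^ explosive_level L <= 32 * L)%N.
  by apply: explosive_level_bounds; lia.
by rewrite -(@leq_exp2l 2) // (leq_trans h) // leq32_exp.
Qed.

Lemma expected_explosions {R : realType} (T s : R) : 0 < T -> 0 < s ->
  exists L0 : nat, forall L, (L0 <= L)%N ->
    L%:R <= (2 ^ (L - explosive_level L))%:R *
      normal_pdf 0 s (threshold T (explosive_level L) + 1).
Proof.
move=> T0 s0.
pose a := s ^+ 2 * T / (64 * 4).
pose K := ((4 * a)^-1 + 1) / s ^+ 2.
pose c := normal_peak s * expR (- K).
have a0 : 0 < a by rewrite !mulr_gt0 ?exprn_gt0 ?invr_gt0.
have sn0 : s != 0 by rewrite gt_eqF.
have c0 : 0 < c by rewrite mulr_gt0 ?expR_gt0 // normal_peak_gt0.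
pose D := 512 * 32 / c.
have D0 : 0 < D by apply: divr_gt0 c0; apply: mulr_gt0; rewrite ltr0n.
have [L0 hL0] := exists_natr_ge D.
exists (maxn 8 L0) => L; rewrite geq_max => /andP[L8 LL0].
have Lgt0 : (0 < L)%N by exact: leq_trans L8.
have LR : 0 < L%:R :> R by rewrite ltr0n.
have /andP[_ l32] := explosive_level_bounds L Lgt0.
have lL := explosive_level_le L L8.
set l := explosive_level L in l32 lL *; set r := threshold T l.
have r0 : 0 < r by exact: threshold_gt0.
have r4 : r ^+ 4 <= 64 * L%:R / T.
  have := thresholdX4 T T0 l; rewrite -/r => /(canRL (mulfK _)) ->.
    have -> : 2 / (T / (2 ^ l)%:R) = 2 * (2 ^ l)%:R / T.
      by rewrite invf_div mulrA.
    rewrite ler_pM2r ?invr_gt0 // (_ : 64 * L%:R = 2 * (32 * L%:R)); last ring.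
    by rewrite ler_pM2l // -natrM ler_nat.
  by rewrite mulf_neq0 ?invr_eq0 ?pnatr_eq0 ?expn_eq0 // gt_eqF.
have r2 : r ^+ 2 <= s ^+ 2 * L%:R / 4 + (4 * a)^-1.
  have ar4 : a * r ^+ 4 <= s ^+ 2 * L%:R / 4.
    have -> : s ^+ 2 * L%:R / 4 = a * (64 * L%:R / T).
      by rewrite /a; field; rewrite gt_eqF.
    by rewrite ler_pM2l.
  suff : r ^+ 2 <= a * r ^+ 4 + (4 * a)^-1 by lra.
  have : 0 <= a * (r ^+ 2 - (2 * a)^-1) ^+ 2 by rewrite mulr_ge0 ?sqr_ge0 ?ltW.
  have -> : a * (r ^+ 2 - (2 * a)^-1) ^+ 2 = a * r ^+ 4 + (4 * a)^-1 - r ^+ 2.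
    by field; rewrite gt_eqF.
  by lra.
have expo : (r + 1) ^+ 2 / (s ^+ 2 *+ 2) <= L%:R * 4^-1 + K.
  rewrite ler_pdivrMr ?pmulrn_lgt0 ?exprn_gt0 //.
  have -> : (L%:R / 4 + K) * (s ^+ 2 *+ 2) =
    (s ^+ 2 * L%:R / 4 + (4 * a)^-1) * 2 + 2.
    by rewrite /K -mulr_natr; field; rewrite sn0 gt_eqF.
  have := sqr_ge0 (r - 1); lra.
have pdf_ge : c * (3 / 4) ^+ L <= normal_pdf 0 s (r + 1).
  rewrite normal_pdfE // /c -mulrA ler_wpM2l ?normal_peak_ge0 //.
  apply: (@le_trans _ _ (expR (- K) * expR (- 4^-1) ^+ L)).
    rewrite ler_wpM2l ?expR_ge0 // lerXn2r ?nnegrE ?expR_ge0 ?divr_ge0 //.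
    by have := expR_ge1Dx (- 4^-1 : R); lra.
  rewrite -expRM_natl -expRD /normal_fun ler_expR subr0 mulNr mulrN.
  by rewrite -opprD lerN2 [leRHS]addrC.
have N_ge : 2 ^+ L / (32 * L%:R) <= (2 ^ (L - l))%:R :> R.
  rewrite ler_pdivrMr ?mulr_gt0 // -natrX -!natrM ler_nat.
  by rewrite -{1}(subnK lL) expnD leq_mul2l l32 orbT.
apply: (@le_trans _ _ (2 ^+ L / (32 * L%:R) * (c * (3 / 4) ^+ L))); last first.
  apply: ler_pM => //.
  by rewrite mulr_ge0 ?(ltW c0) // exprn_ge0 // divr_ge0.
have cube : L%:R ^+ 3 / 512 <= (3 / 2) ^+ L :> R.
  have b : 1 + L%:R / 8 <= (9 / 8) ^+ L :> R.
    elim: (L) => [|n IHn]; first by rewrite mul0r addr0 expr0.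
    rewrite exprS -natr1.
    have : 0 <= n%:R :> R by [].
    lra.
  apply: (@le_trans _ _ (((9 / 8) ^+ L) ^+ 3)).
    rewrite (_ : _ / 512 = (L%:R / 8) ^+ 3); last by field.
    by rewrite lerXn2r ?nnegrE ?exprn_ge0 ?divr_ge0 //; lra.
  by rewrite exprAC lerXn2r ?nnegrE ?exprn_ge0 ?divr_ge0 //; lra.
have -> : 2 ^+ L / (32 * L%:R) * (c * (3 / 4) ^+ L) =
  (3 / 2) ^+ L * (c / (32 * L%:R)).
  have -> : (3 / 2) ^+ L = 2 ^+ L * (3 / 4) ^+ L :> R.
    by rewrite -exprMn; congr (_ ^+ _); field.
  move: (2 ^+ L) ((3 / 4) ^+ L) => u v.
  by field; rewrite gt_eqF.
apply: (@le_trans _ _ (L%:R ^+ 3 / 512 * (c / (32 * L%:R)))); last first.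
  by rewrite ler_wpM2r // divr_ge0 ?(ltW c0) // mulr_ge0.
have -> : L%:R ^+ 3 / 512 * (c / (32 * L%:R)) = L%:R * (L%:R / D).
  by rewrite /D; field; rewrite !gt_eqF.
rewrite ler_peMr ?(ltW LR) // ler_pdivlMr // mul1r.
by apply: (le_trans hL0); rewrite ler_nat.
Qed.

Section almost_sure_events.
Context {R : realType} {d : measure_display} {Omega : measurableType d}
  (P : probability Omega R).
Variables (T sigma : R) (xi : nat * nat -> {RV P >-> R}).
Hypotheses (T_gt0 : 0 < T) (sigma_gt0 : 0 < sigma).
Hypothesis xi_normal : forall l k : nat, (0 < k)%N ->
  normally_distributed 0 sigma (xi (l, k)).
Hypothesis xi_indep :
  mutually_independent [set lk : nat * nat | (0 < lk.2)%N] xi.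

Let c : R := normal_peak sigma.
Let c_ge0 : 0 <= c. Proof. exact: normal_peak_ge0. Qed.

Lemma xi_prob l k (A : set R) : (0 < k)%N -> measurable A ->
  P (xi (l, k) @^-1` A) = normal_prob 0 sigma A.
Proof. by move=> k0 mA; rewrite -(xi_normal l k k0 A mA). Qed.

Lemma measurable_xi i (A : set R) : measurable A -> measurable (xi i @^-1` A).
Proof. exact: measurable_funPTI. Qed.

Definition large_sample (L : nat) : set Omega :=
  \bigcup_(l in [set` iota 0 L.+1]) \bigcup_(k in [set` iota 1 (2 ^ L)])
    xi (l, k) @^-1` [set y | 2 ^+ (3 * L) < `|y|].

Definition sample_near_threshold (L : nat) : set Omega :=
  \bigcup_(l in [set` iota 0 L.+1]) \bigcup_(j in [set` iota 0 L.+1])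
    \bigcup_(k in [set` iota 1 (2 ^ L)])
    xi (l, k) @^-1` [set y | `| `|y| - threshold T j| <= 2^-1 ^+ (10 * L)].

(* Two samples of modulus at most [2 ^ (3 L)] at distance at most [e] both lie
   within [2 e] of one of the grid points [i e], [i <= 2 ^ (13 L)]. *)
Definition near_samples (L : nat) : set Omega :=
  \bigcup_(l in [set` iota 0 L]) \bigcup_(k in [set` iota 1 (2 ^ L)])
    \bigcup_(j in [set` iota 1 (2 ^ L)])
    \bigcup_(i in [set` iota 0 (2 ^ (13 * L)).+1])
    (xi (l, k) @^-1`
       [set y | `| `|y| - i%:R * 2^-1 ^+ (10 * L)| <= 2 * 2^-1 ^+ (10 * L)] `&`
     xi (l.+1, j) @^-1`
       [set y | `| `|y| - i%:R * 2^-1 ^+ (10 * L)| <= 2 * 2^-1 ^+ (10 * L)]).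

Definition no_explosion (L : nat) : set Omega :=
  let l := explosive_level L in
  \bigcap_(i in [set` [seq (l, k) | k <- iota 1 (2 ^ (L - l))]])
    xi i @^-1` (~` [set y | threshold T l < `|y|]).

Let bigcup_iota_measurable a n (A : nat -> set Omega) :
  (forall k, measurable (A k)) ->
  measurable (\bigcup_(k in [set` iota a n]) A k).
Proof. by move=> mA; apply: bigcup_measurable. Qed.

Let leS_exp2 (L : nat) : L.+1%:R <= 2 ^+ L :> R.
Proof. by rewrite -natrX ler_nat ltn_expl. Qed.

Lemma large_sample_rare :
  {ae P, forall w, exists n, forall L, (n <= L)%N -> ~ large_sample L w}.
Proof.
pose C := 16 / 3 * sigma ^+ 2.
have C0 : 0 <= C by rewrite mulr_ge0 ?sqr_ge0.
apply: (@borel_cantelli_geometric _ _ _ _ _ C 0) => // [L|L _].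
  do 2!apply: bigcup_iota_measurable => ?.
  by apply: measurable_xi; exact: measurable_norm_gt.
apply: (@le_trans _ _
    (L.+1%:R * ((2 ^ L)%:R * (C / (2 ^+ (3 * L)) ^+ 2)))%:E).
  apply: iota_union_bound => l _.
    apply: bigcup_iota_measurable => k.
    by apply: measurable_xi; exact: measurable_norm_gt.
  apply: iota_union_bound => k /andP[k0 _].
    by apply: measurable_xi; exact: measurable_norm_gt.
  rewrite xi_prob //; last exact: measurable_norm_gt.
  exact: normal_prob_tail_le.
rewrite lee_fin natrX exprVn mulnC exprM.
have N1 := exp2_ge1 (R := R) L; have LN := leS_exp2 L.
move: (2 ^+ L) N1 LN => N N1 LN.
have N0 : 0 < N by lra.
have CN : 0 <= N * (C / N ^+ 3 ^+ 2).
  by rewrite mulr_ge0 ?divr_ge0 ?exprn_ge0 ?(ltW N0).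
apply: le_trans (ler_wpM2r CN LN) _.
have -> : N * (N * (C / N ^+ 3 ^+ 2)) = C / N * (N ^+ 3)^-1.
  by field; rewrite gt_eqF.
rewrite ler_piMr ?divr_ge0 ?(ltW N0) // invf_le1 ?exprn_gt0 //.
exact: exprn_ege1.
Qed.

Lemma sample_near_threshold_rare :
  {ae P, forall w, exists n, forall L, (n <= L)%N ->
    ~ sample_near_threshold L w}.
Proof.
apply: (@borel_cantelli_geometric _ _ _ _ _ (4 * c) 0) => // [|L|L _].
- by rewrite mulr_ge0.
- do 3!apply: bigcup_iota_measurable => ?.
  by apply: measurable_xi; exact: measurable_norm_near.
apply: (@le_trans _ _ (L.+1%:R * (L.+1%:R * ((2 ^ L)%:R *
    (4 * c * 2^-1 ^+ (10 * L)))))%:E).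
  apply: iota_union_bound => l _.
    do 2!apply: bigcup_iota_measurable => ?.
    by apply: measurable_xi; exact: measurable_norm_near.
  apply: iota_union_bound => j _.
    apply: bigcup_iota_measurable => ?.
    by apply: measurable_xi; exact: measurable_norm_near.
  apply: iota_union_bound => k /andP[k0 _].
    by apply: measurable_xi; exact: measurable_norm_near.
  rewrite xi_prob //; last exact: measurable_norm_near.
  by apply: normal_prob_near_le => //; rewrite exprn_ge0 // invr_ge0.
rewrite lee_fin natrX mulnC exprM !exprVn.
have N1 := exp2_ge1 (R := R) L; have LN := leS_exp2 L.
move: (2 ^+ L) N1 LN => N N1 LN.
have N0 : 0 < N by lra.
apply: (@le_trans _ _ (N * (N * (N * (4 * c * N ^- 10))))).
  by rewrite !ler_pM // ?mulr_ge0 ?invr_ge0 ?exprn_ge0 ?(ltW N0) // ler_pM //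
    ?mulr_ge0 ?invr_ge0 ?exprn_ge0 ?(ltW N0).
have -> : N * (N * (N * (4 * c * N ^- 10))) = 4 * c / N * (N ^+ 6)^-1.
  by field; rewrite gt_eqF.
rewrite ler_piMr ?mulr_ge0 ?invr_ge0 ?(ltW N0) // invf_le1 ?exprn_gt0 //.
exact: exprn_ege1.
Qed.

Lemma near_samples_rare :
  {ae P, forall w, exists n, forall L, (n <= L)%N -> ~ near_samples L w}.
Proof.
apply: (@borel_cantelli_geometric _ _ _ _ _ (128 * c ^+ 2) 0) => // [|L|L _].
- by rewrite mulr_ge0 ?sqr_ge0.
- do 4!apply: bigcup_iota_measurable => ?.
  by apply: measurableI; apply: measurable_xi; exact: measurable_norm_near.
rewrite /near_samples; set e := 2^-1 ^+ (10 * L).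
have e0 : 0 <= e by rewrite exprn_ge0 // invr_ge0.
apply: (@le_trans _ _ (L%:R * ((2 ^ L)%:R * ((2 ^ L)%:R *
   ((2 ^ (13 * L)).+1%:R * (4 * c * (2 * e) * (4 * c * (2 * e)))))))%:E).
  apply: iota_union_bound => l _.
    do 3!apply: bigcup_iota_measurable => ?.
    by apply: measurableI; apply: measurable_xi; exact: measurable_norm_near.
  apply: iota_union_bound => k /andP[k0 _].
    do 2!apply: bigcup_iota_measurable => ?.
    by apply: measurableI; apply: measurable_xi; exact: measurable_norm_near.
  apply: iota_union_bound => j /andP[j0 _].
    apply: bigcup_iota_measurable => ?.
    by apply: measurableI; apply: measurable_xi; exact: measurable_norm_near.
  apply: iota_union_bound => i _.
    by apply: measurableI; apply: measurable_xi; exact: measurable_norm_near.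
  set A := [set y | _].
  have mA : measurable A by exact: measurable_norm_near.
  have lk : (l, k) != (l.+1, j) by rewrite xpair_eqE ltn_eqF.
  have := xi_indep [:: (l, k); (l.+1, j)] (fun=> A).
  rewrite /= inE lk big_cons big_seq1 => /(_ isT) indep.
  have -> : xi (l, k) @^-1` A `&` xi (l.+1, j) @^-1` A =
      \bigcap_(i in [set` [:: (l, k); (l.+1, j)]]) xi i @^-1` A.
    apply/seteqP; split => [w [Aw1 Aw2] m /=|w Aw].
      by rewrite !inE => /orP[/eqP|/eqP] ->.
    by split; apply: Aw; rewrite /= !inE eqxx ?orbT.
  rewrite indep // ?EFinM => [|m]; last by rewrite !inE => /orP[/eqP|/eqP] ->.
  by rewrite !xi_prob // -EFinM; apply: lee_pmul => //;
    apply: normal_prob_near_le => //; rewrite mulr_ge0.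
rewrite lee_fin -[_.+1%:R]natr1 !natrX /e ![(_ * L)%N]mulnC !exprM.
rewrite ![2^-1 ^+ _]exprVn ![(2 ^- L) ^+ _]exprVn.
have N1 := exp2_ge1 (R := R) L; have LN := exp2_ge_self (R := R) L.
move: (2 ^+ L) N1 LN => N N1 LN.
have N0 : 0 < N by lra.
have i0 : 0 <= N ^- 10 by rewrite invr_ge0 exprn_ge0 ?ltW.
have N13 : N ^+ 13 + 1 <= 2 * N ^+ 13.
  by have := exprn_ege1 13 N1; lra.
apply: (@le_trans _ _ (N * (N * (N * (2 * N ^+ 13 *
    (4 * c * (2 * N ^- 10) * (4 * c * (2 * N ^- 10)))))))).
  have X0 : 0 <= 4 * c * (2 * N ^- 10) * (4 * c * (2 * N ^- 10)).
    by rewrite !mulr_ge0.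
  have n0 := ltW N0.
  by rewrite ler_pM ?mulr_ge0 ?addr_ge0 ?exprn_ge0 // !ler_wpM2l // ler_wpM2r.
have -> : N * (N * (N * (2 * N ^+ 13 *
    (4 * c * (2 * N ^- 10) * (4 * c * (2 * N ^- 10)))))) =
    128 * c ^+ 2 / N * (N ^+ 3)^-1.
  by field; rewrite gt_eqF.
rewrite ler_piMr ?mulr_ge0 ?invr_ge0 ?sqr_ge0 ?(ltW N0) //.
by rewrite invf_le1 ?exprn_gt0 // exprn_ege1.
Qed.

Lemma no_explosion_rare :
  {ae P, forall w, exists n, forall L, (n <= L)%N -> ~ no_explosion L w}.
Proof.
have [L0 hL0] := expected_explosions T sigma T_gt0 sigma_gt0.
have mE l : measurable (~` [set y : R | threshold T l < `|y|]).
  by apply: measurableC; exact: measurable_norm_gt.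
apply: (@borel_cantelli_geometric _ _ _ _ _ 1 L0) => // [L|L LL0].
  by apply: fin_bigcap_measurable => // i _; exact: measurable_xi.
rewrite mul1r /no_explosion; set l := explosive_level L.
set n := (2 ^ (L - l))%N; set A := ~` _.
set q := normal_pdf 0 sigma (threshold T l + 1).
have mA : measurable A by exact: mE.
rewrite (xi_indep _ (fun=> A)) //; first last.
- by move=> i /mapP[k]; rewrite mem_iota => /andP[k0 _] ->.
- by rewrite map_inj_uniq ?iota_uniq // => a b [].
apply: (@le_trans _ _ ((expR (- q)) ^+ n)%:E).
  rewrite -[n in X in (_ <= X)%E](size_iota 1) -(size_map (pair l)).
  apply: prode_le_exp => // i /mapP[k]; rewrite mem_iota => /andP[k0 _] ->.
  rewrite xi_prob // /A probability_setC; last exact: measurable_norm_gt.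
  apply: (@le_trans _ _ (1 - q%:E)%E).
    by apply: leeB => //; apply: normal_prob_tail_ge => //; exact: sqrtr_ge0.
  by rewrite -EFinB lee_fin; exact: expR_ge1Dx.
rewrite lee_fin -expRM_natl mulrN.
apply: (@le_trans _ _ (expR (- L%:R))).
  by rewrite ler_expR lerN2; apply: hL0.
rewrite -(mulr1 L%:R) -mulrN expRM_natl expRN lerXn2r ?nnegrE
  ?invr_ge0 ?expR_ge0 //.
rewrite lef_pV2 ?posrE ?expR_gt0 //.
by have := expR_ge1Dx (1 : R); lra.
Qed.

End almost_sure_events.

Lemma in_set_iota (a n k : nat) : (a <= k < a + n)%N -> [set` iota a n] k.
Proof. by rewrite /= mem_iota. Qed.

Theorem theorem4p1 (R : realType) (T sigma : R) (T_gt0 : 0 < T)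
  (sigma_gt0 : 0 < sigma)
  (d : measure_display) (Omega : measurableType d) (P : probability Omega R)
  (xi : nat * nat -> {RV P >-> R})
  (xi_normal : forall l k : nat, (0 < k)%N ->
     normally_distributed 0 sigma (xi (l, k)))
  (xi_indep : mutually_independent [set lk : nat * nat | (0 < lk.2)%N] xi) :
  forall p : R, 0 < p ->
    {ae P, forall w : Omega,
      `|mlmc_euler T p (fun l k => xi (l, k) w) N|
        @[N --> within positive_powers_of_two \oo] --> +oo}.
Proof.
move=> p p_gt0.
have thr0 : 0 < threshold T 0 `^ p by rewrite powR_gt0 // threshold_gt0.
have [a1 ha1] := exp2_unbounded 1 (1 + T) ltr01.
have [a2 ha2] := exp2_unbounded p 3 p_gt0.
have [a3 ha3] := exp2_unbounded _ 4 thr0.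
have R1 := large_sample_rare P sigma xi sigma_gt0 xi_normal.
have R2 := sample_near_threshold_rare P T sigma xi sigma_gt0 xi_normal.
have R3 := near_samples_rare P sigma xi sigma_gt0 xi_normal xi_indep.
have R4 := no_explosion_rare P T sigma xi T_gt0 sigma_gt0 xi_normal xi_indep.
apply: filterS (filterI (filterI R1 R2) (filterI R3 R4)).
move=> w [[[n1 hn1] [n2 hn2]] [[n3 hn3] [n4 hn4]]].
apply/cvgryPge => A; have [a4 ha4] := exists_natr_ge A.
pose L0 := (8 + (a1 + a2 + a3 + a4) + (n1 + n2 + n3 + n4))%N.
exists (2 ^ L0)%N => // N /= L0N [L _ NL]; move: L0N; rewrite {}NL.
rewrite leq_exp2l // => L0L.
have L8 : (8 <= L)%N by lia.
have LA : A <= L%:R by rewrite (le_trans ha4) // ler_nat; lia.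
have [Ln1 Ln2 Ln3 Ln4] : [/\ n1 <= L, n2 <= L, n3 <= L & n4 <= L]%N.
  by split; lia.
apply: (le_trans LA).
have Lgt0 : (0 < L)%N by lia.
have x_ub l k : (l <= L)%N -> (0 < k <= 2 ^ L)%N ->
    `|xi (l, k) w| <= 2 ^+ (3 * L).
  move=> lL kL; rewrite leNgt; apply/negP => xB; apply: (hn1 L Ln1).
  exists l; first exact: in_set_iota.
  by exists k => //; apply: in_set_iota; rewrite add1n ltnS.
apply: mlmc_euler_ge => //.
- by have := ha1 L; rewrite mul1r; apply; lia.
- by apply: ha2; lia.
- by apply: ha3; lia.
- move=> l j k lL jL kL; rewrite ltNge; apply/negP => xB; apply: (hn2 L Ln2).
  exists l; first exact: in_set_iota.
  exists j; first exact: in_set_iota.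
  by exists k => //; apply: in_set_iota; rewrite add1n ltnS.
- move=> l j k lL kL jL; rewrite ltNge; apply/negP => xB; apply: (hn3 L Ln3).
  exists l; first exact: in_set_iota.
  exists k; first by apply: in_set_iota; rewrite add1n ltnS.
  exists j; first by apply: in_set_iota; rewrite add1n ltnS.
  have aB := x_ub l k (ltnW lL) kL.
  move: xB aB; set e := 2^-1 ^+ (10 * L).
  set a := `|xi (l, k) w|; set b := `|xi (l.+1, j) w| => ab aB.
  have e0 : 0 < e by rewrite exprn_gt0 // invr_gt0.
  have ae0 : 0 <= a / e by rewrite divr_ge0 ?normr_ge0 ?(ltW e0).
  have /andP[i1 i2] := truncn_itv ae0; set i := Num.truncn (a / e) in i1 i2.
  rewrite ler_pdivlMr // in i1; rewrite ltr_pdivrMr // in i2.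
  exists i.
    apply: in_set_iota; rewrite leq0n add0n ltnS -(ler_nat R) natrX.
    rewrite -(ler_pM2r e0); apply: (le_trans i1); apply: (le_trans aB).
    have -> : (13 * L = 3 * L + 10 * L)%N by lia.
    by rewrite /e exprVn exprD mulfK // expf_neq0.
  rewrite -natr1 mulrDl mul1r in i2.
  move: ab; rewrite !ler_norml => /andP[ab1 ab2].
  by split; rewrite /= ler_norml -/a -/b -/e; apply/andP; split; lra.
have /andP[l1 _] := explosive_level_bounds L Lgt0.
have lL := explosive_level_le L L8.
apply: contrapT => noex; apply: (hn4 L Ln4) => -[_ _] /= /mapP[k + [-> ->]].
rewrite mem_iota add1n ltnS => kL /= xk; apply: noex.
by exists (explosive_level L), k.
Qed.
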